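(* Let $m\ge n\ge 2$ and let $K_1\subset\mathbb{R}^n$ and $K_2\subset\mathbb{R}^m$ be proper cones. Let $S_1\in\pi(\mathbb{R}^n_+,K_1)$, $S_2\in\pi(\mathbb{R}^n_+,K_1^* )$, $T_1\in\pi(\mathbb{R}^m_+,K_2^* )$ and $T_2\in\pi(\mathbb{R}^m_+,K_2)$ be invertible matrices. Define linear maps on $M_{m,n}$ by $\widetilde{T_1}(A)=T_1^tAS_1$ and $\widetilde{T_2}(A)=T_2AS_2^t$. If $L:M_{m,n}\to M_{m,n}$ is a linear map with $L(S(K_1,K_2))=S(K_1,K_2)$, then the composition $\widetilde{L_1}=\widetilde{T_1}L\widetilde{T_2}$ satisfies $\widetilde{L_1}(\pi(\mathbb{R}^n_+,\mathbb{R}^m_+))\subset\pi(\mathbb{R}^n_+,\mathbb{R}^m_+)$.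
   Context: $M_{m,n}$ is the space of real $m\times n$ matrices and $\mathbb{R}^n_+$ is the nonnegative orthant. A convex cone $K\subseteq\mathbb{R}^n$ is a set with $K+K\subseteq K$ and $\alpha K\subseteq K$ for all $\alpha\ge 0$; it is proper if it is closed, pointed ($K\cap -K=\{0\}$) and has nonempty interior $K^\circ$. Its dual is $K^*=\{y\in\mathbb{R}^n:\langle y,x\rangle\ge 0\ \forall x\in K\}$. For proper cones $C_1\subset\mathbb{R}^p$, $C_2\subset\mathbb{R}^q$, $\pi(C_1,C_2)$ is the set of $q\times p$ real matrices $A$ with $A(C_1)\subseteq C_2$. $S(K_1,K_2)$ is the set of $A\in M_{m,n}$ for which there exists $x\in K_1^\circ$ with $Ax\in K_2^\circ$. *)

(* Defs.v *)
From HB Require Import structures.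
From mathcomp Require Import all_boot all_order all_algebra.
From mathcomp Require Import classical_sets reals topology normedtype.
Import Order.TTheory GRing.Theory Num.Theory.
Import numFieldNormedType.Exports.

Set Implicit Arguments.
Unset Strict Implicit.
Unset Printing Implicit Defensive.

Local Open Scope classical_set_scope.
Local Open Scope ring_scope.

Definition orthant (R : realType) (n : nat) : set 'cV[R]_n :=
  [set x | forall i, 0 <= x i 0].

Definition inner (R : realType) (n : nat) (y x : 'cV[R]_n) : R :=
  \sum_(i < n) y i 0 * x i 0.

Definition convex_cone (R : realType) (n : nat) (K : set 'cV[R]_n) : Prop :=
  (forall x y, K x -> K y -> K (x + y)) /\
  (forall (a : R) x, 0 <= a -> K x -> K (a *: x)).

Definition pointed_cone (R : realType) (n : nat) (K : set 'cV[R]_n) : Prop :=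
  K `&` [set - x | x in K] = [set 0].

Definition proper_cone (R : realType) (n : nat) (K : set 'cV[R]_n) : Prop :=
  [/\ convex_cone K, closed K, pointed_cone K & interior K !=set0].

Definition dual_cone (R : realType) (n : nat) (K : set 'cV[R]_n) :
    set 'cV[R]_n :=
  [set y | forall x, K x -> 0 <= inner y x].

(* Matrices act on column vectors, so a map from R^p to R^q is q x p. *)
Definition cone_maps (R : realType) (p q : nat)
    (C1 : set 'cV[R]_p) (C2 : set 'cV[R]_q) : set 'M[R]_(q, p) :=
  [set A | [set A *m x | x in C1] `<=` C2].

Definition semipositive (R : realType) (n m : nat)
    (K1 : set 'cV[R]_n) (K2 : set 'cV[R]_m) : set 'M[R]_(m, n) :=
  [set A | exists x, interior K1 x /\ interior K2 (A *m x)].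

Definition tildeT1 (R : realType) (m n : nat) (T1 : 'M[R]_m) (S1 : 'M[R]_n)
    (A : 'M[R]_(m, n)) : 'M[R]_(m, n) := T1^T *m A *m S1.

Definition tildeT2 (R : realType) (m n : nat) (T2 : 'M[R]_m) (S2 : 'M[R]_n)
    (A : 'M[R]_(m, n)) : 'M[R]_(m, n) := T2 *m A *m S2^T.

(* Main.v *)
Require Import Defs.
From HB Require Import structures.
From mathcomp Require Import all_boot all_order all_algebra.
From mathcomp Require Import classical_sets reals topology normedtype.
Import Order.TTheory GRing.Theory Num.Theory.
Import numFieldNormedType.Exports.

Set Implicit Arguments.
Unset Strict Implicit.
Unset Printing Implicit Defensive.

Local Open Scope classical_set_scope.
Local Open Scope ring_scope.

(** The set [S = semipositive K1 K2] determines the cone of linear maps sending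
    [K1] into [K2]: a matrix [A] is such a map exactly when [A + S] lies in [S].
    One implication holds because [K2 + interior K2] lies in [interior K2].  For
    the other, if [A] moves some [x] of [K1] to the negative side of a
    functional [t] of the dual of [K2], one can build a rank one [B] in [S]
    with [t^T (A + B) = 0], and then [A + B] is not in [S], since a
    nonzero functional of the dual cone is positive on the interior.  The two
    implications are [semipositive_absorbs] and [absorbed_direction_ge0].

    A linear [L] with [L(S) = S] preserves the property [A + S] inside [S],
    since [L A + S = L (A + S)].  So [L] maps cone maps to cone maps.  The outer
    factors only translate between orthants and cones: [T2 A S2^T] maps [K1]
    to [K2] when [A] is nonnegative, and the entries of [T1^T C S1] are values
    [t^T C x] with [t] in the dual of [K2] and [x] in [K1]. *)

Lemma innerE (R : realType) (n : nat) (y x : 'cV[R]_n) :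
  inner y x = (y^T *m x) 0 0.
Proof. by rewrite mxE; apply: eq_bigr => i _; rewrite mxE. Qed.

Lemma innerDr (R : realType) (n : nat) (t x y : 'cV[R]_n) :
  inner t (x + y) = inner t x + inner t y.
Proof. by rewrite !innerE mulmxDr mxE. Qed.

Lemma innerZr (R : realType) (n : nat) (a : R) (t x : 'cV[R]_n) :
  inner t (a *: x) = a * inner t x.
Proof. by rewrite !innerE -scalemxAr mxE. Qed.

Lemma inner_adj (R : realType) (m n : nat) (A : 'M[R]_(m, n))
    (y : 'cV[R]_m) (x : 'cV[R]_n) :
  inner (A^T *m y) x = inner y (A *m x).
Proof. by rewrite !innerE trmx_mul trmxK mulmxA. Qed.

Lemma inner_gt0 (R : realType) (n : nat) (t : 'cV[R]_n) :
  t != 0 -> 0 < inner t t.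
Proof.
move=> t0; have ge0 i : 0 <= t i 0 * t i 0 by rewrite -expr2 sqr_ge0.
rewrite lt_neqAle sumr_ge0 // andbT eq_sym; apply: contra t0.
rewrite psumr_eq0 // => /allP h; apply/eqP/colP => i; rewrite mxE.
by have /eqP := h i (mem_index_enum i); move/eqP; rewrite mulf_eq0 orbb => /eqP.
Qed.

Lemma inner_delta (R : realType) (n : nat) (i : 'I_n) (x : 'cV[R]_n) :
  inner (delta_mx i 0) x = x i 0.
Proof. by rewrite innerE trmx_delta -rowE mxE. Qed.

Lemma delta_orthant (R : realType) (n : nat) (i : 'I_n) :
  orthant (delta_mx i 0 : 'cV[R]_n).
Proof. by move=> j; rewrite mxE ler0n. Qed.

(** A translate of a neighbourhood of [w] by [k] is a neighbourhood of
    [k + w], still inside [K + K]. *)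
Lemma interior_coneD (R : realType) (n : nat) (K : set 'cV[R]_n)
    (k w : 'cV[R]_n) :
  convex_cone K -> K k -> K° w -> K° (k + w).
Proof.
move=> [cD _] Kk Kw; have c : y - k @[y --> k + w] --> w.
  rewrite -[X in _ --> X](addrK k w) [w + k]addrC.
  exact: (cvgB cvg_id (cvg_cst _)).
apply: (@filterS _ (nbhs (k + w))) (c _ Kw) => y /= Ky.
by rewrite -(subrK k y); apply: cD.
Qed.

Lemma interior_coneZ (R : realType) (n : nat) (K : set 'cV[R]_n)
    (a : R) (w : 'cV[R]_n) :
  convex_cone K -> 0 < a -> K° w -> K° (a *: w).
Proof.
move=> [_ cZ] a0 Kw; have c : a^-1 *: y @[y --> a *: w] --> w.
  rewrite -[X in _ --> X](scalerK (lt0r_neq0 a0) w).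
  exact: (cvgZl_tmp cvg_id).
apply: (@filterS _ (nbhs (a *: w))) (c _ Kw) => y /= Ky.
by rewrite -(scalerKV (lt0r_neq0 a0) y); apply: cZ => //; exact: ltW.
Qed.

Lemma interior_room (R : realType) (n : nat) (K : set 'cV[R]_n)
    (w v : 'cV[R]_n) : K° w ->
  exists2 e : R, 0 < e & K (w - e *: v).
Proof.
move=> Kw; have c : w - e *: v @[e --> (0 : R)^'+] --> w.
  rewrite -[X in _ --> X](subr0 w) -(scale0r v).
  apply: cvgB; first exact: cvg_cst.
  by apply: cvgZr_tmp; apply: cvg_at_right_filter; exact: cvg_id.
have /filter_ex[e [e0 Ke]] : \forall e \near (0 : R)^'+,
    0 < e /\ K (w - e *: v).
  near=> e; split; first by near: e; exact: nbhs_right_gt.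
  by near: e; exact: c.
by exists e.
Unshelve. all: by end_near. Qed.

(** If [t] vanished at, or were negative at, an interior point [w], then moving
    from [w] against [t] inside [K] would make it negative. *)
Lemma dual_interior_gt0 (R : realType) (n : nat) (K : set 'cV[R]_n)
    (t w : 'cV[R]_n) :
  dual_cone K t -> t != 0 -> K° w -> 0 < inner t w.
Proof.
move=> Kt t0 /(interior_room t)[e e0 /Kt].
rewrite -scaleNr innerDr innerZr mulNr subr_ge0; apply: lt_le_trans.
by rewrite mulr_gt0 // inner_gt0.
Qed.

Lemma semipositive_absorbs (R : realType) (n m : nat)
    (K1 : set 'cV[R]_n) (K2 : set 'cV[R]_m) (A B : 'M[R]_(m, n)) :
  convex_cone K2 -> cone_maps K1 K2 A -> semipositive K1 K2 B ->
  semipositive K1 K2 (A + B).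
Proof.
move=> cK2 hA [x [K1x K2Bx]]; exists x; split=> //.
rewrite mulmxDl; apply: interior_coneD => //.
by apply: hA; exists x => //; exact: interior_subset.
Qed.

(** If [t^T A x < 0], then [B = - k t^T A / t^T k], with [k] interior to [K2], is
    semipositive while [t^T (A + B) = 0].  The conclusion says that [A] sends
    [K1] into the bidual of [K2]; in this form it needs no separation
    theorem. *)
Lemma absorbed_direction_ge0 (R : realType) (n m : nat)
    (K1 : set 'cV[R]_n) (K2 : set 'cV[R]_m) (A : 'M[R]_(m, n)) :
  convex_cone K1 -> K1° !=set0 -> convex_cone K2 -> K2° !=set0 ->
  (forall B, semipositive K1 K2 B -> semipositive K1 K2 (A + B)) ->
  forall t x, dual_cone K2 t -> K1 x -> 0 <= inner t (A *m x).
Proof.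
move=> cK1 [u K1u] cK2 [k K2k] absA t x K2t K1x.
rewrite leNgt; apply/negP => neg.
have t0 : t != 0.
  by apply: contraTneq neg => ->; rewrite innerE trmx0 mul0mx mxE ltxx.
have tk : 0 < inner t k by exact: dual_interior_gt0 K2k.
(* The point z pushes x into the interior; the step e is small enough, since
   e * t^T A u < e * c = - t^T A x, to keep the pairing negative. *)
pose c := `|inner t (A *m u)| + 1.
have c0 : 0 < c by rewrite ltr_wpDl.
pose e := - inner t (A *m x) / c.
have e0 : 0 < e by rewrite divr_gt0 // oppr_gt0.
pose z := x + e *: u.
have K1z : K1° z by apply: interior_coneD => //; exact: interior_coneZ.
have tz : inner t (A *m z) < 0.
  rewrite mulmxDr -scalemxAr innerDr innerZr.
  rewrite -(subrr (inner t (A *m x))) ltrD2l.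
  rewrite -[X in _ < X](divfK (lt0r_neq0 c0)) ltr_pM2l //.
  by apply: le_lt_trans (ler_norm _) _; rewrite ltrDl.
(* Normalized so that t^T B = - t^T A; this sign also makes B z a positive
   multiple of k. *)
pose B : 'M[R]_(m, n) := - ((inner t k)^-1 *: (k *m (t^T *m A))).
have BE v : B *m v = - ((inner t k)^-1 * inner t (A *m v)) *: k.
  rewrite mulNmx -scalemxAl -!mulmxA [t^T *m _]mx11_scalar -innerE.
  by rewrite mul_mx_scalar scalerA scaleNr.
have /absA[v [_ K2v]] : semipositive K1 K2 B.
  exists z; split=> //; rewrite BE; apply: interior_coneZ => //.
  by rewrite -mulrN mulr_gt0 ?invr_gt0 // oppr_gt0.
have := dual_interior_gt0 K2t t0 K2v.
rewrite mulmxDl BE innerDr innerZr mulNr mulrAC mulVf ?lt0r_neq0 // mul1r.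
by rewrite subrr ltxx.
Qed.

Theorem theorem3p40 (R : realType) (m n : nat)
  (hn : (2 <= n)%N) (hmn : (n <= m)%N)
  (K1 : set 'cV[R]_n) (K2 : set 'cV[R]_m)
  (hK1 : proper_cone K1) (hK2 : proper_cone K2)
  (S1 S2 : 'M[R]_n) (T1 T2 : 'M[R]_m)
  (hS1 : cone_maps (@orthant R n) K1 S1)
  (hS2 : cone_maps (@orthant R n) (dual_cone K1) S2)
  (hT1 : cone_maps (@orthant R m) (dual_cone K2) T1)
  (hT2 : cone_maps (@orthant R m) K2 T2)
  (uS1 : S1 \in unitmx) (uS2 : S2 \in unitmx)
  (uT1 : T1 \in unitmx) (uT2 : T2 \in unitmx)
  (L : {linear 'M[R]_(m, n) -> 'M[R]_(m, n)})
  (hL : [set L A | A in semipositive K1 K2] = semipositive K1 K2) :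
  [set (tildeT1 T1 S1 \o L \o tildeT2 T2 S2) A
     | A in cone_maps (@orthant R n) (@orthant R m)]
  `<=` cone_maps (@orthant R n) (@orthant R m).
Proof.
have [cK1 _ _ K1i] := hK1; have [cK2 _ _ K2i] := hK2.
move=> _ [A hA <-] /= _ [x ox <-] i.
have K12 : cone_maps K1 K2 (T2 *m A *m S2^T).
  move=> _ [y K1y <-]; rewrite -!mulmxA; apply: hT2; exists (A *m (S2^T *m y)) => //.
  apply: hA; exists (S2^T *m y) => // j.
  rewrite -inner_delta -inner_adj trmxK; apply: hS2 => //.
  by exists (delta_mx j 0) => //; exact: delta_orthant.
have absL B : semipositive K1 K2 B ->
    semipositive K1 K2 (L (T2 *m A *m S2^T) + B).
  rewrite -{1}hL => -[D hD <-]; rewrite -raddfD -hL.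
  exists (T2 *m A *m S2^T + D) => //; exact: semipositive_absorbs.
rewrite -inner_delta -!mulmxA -inner_adj trmxK.
apply: (absorbed_direction_ge0 cK1 K1i cK2 K2i absL).
  by apply: hT1; exists (delta_mx i 0) => //; exact: delta_orthant.
by apply: hS1; exists x.
Qed.
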